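(* Let $\mathfrak{B}_1$ and $\mathfrak{B}_2$ be countably infinite $\omega$-categorical structures with disjoint relational signatures. Then $\mathfrak{B}_1$ and $\mathfrak{B}_2$ have a generic combination if and only if either both $\mathfrak{B}_1$ and $\mathfrak{B}_2$ do not have algebraicity, or one of $\mathfrak{B}_1$ and $\mathfrak{B}_2$ does have algebraicity and the other has an automorphism group which is $n$-transitive for all $n \in \mathbb{N}$.
   Context: All signatures are assumed to be countable. A theory is $\omega$-categorical if it has, up to isomorphism, only one countable model; a structure is $\omega$-categorical if its first-order theory is. $\operatorname{Th}(\mathfrak{B})$ denotes the set of first-order sentences true in $\mathfrak{B}$. For a structure $\mathfrak{B}$ whose signature contains $\tau$, $\mathfrak{B}^{\tau}$ denotes its $\tau$-reduct. A tuple is injective if its entries are pairwise distinct. For a permutation group $G$ on $B$ and $a \in B^n$, $Ga = \{(\alpha(a_1),\dots,\alpha(a_n)) \mid \alpha \in G\}$ is the orbit of $a$. Generic combination: Let $\mathfrak{B}_1,\mathfrak{B}_2$ be countably infinite $\omega$-categorical structures with disjoint relational signatures $\tau_1,\tau_2$. A generic combination of $\mathfrak{B}_1$ and $\mathfrak{B}_2$ is a countably infinite $(\tau_1\cup\tau_2)$-structure $\mathfrak{B}$ that is a model of $\operatorname{Th}(\mathfrak{B}_1)\cup\operatorname{Th}(\mathfrak{B}_2)$ such that (i) for all $k\in\mathbb{N}$ and all injective $a,b\in B^k$, $\operatorname{Aut}(\mathfrak{B}^{\tau_1})a\cap\operatorname{Aut}(\mathfrak{B}^{\tau_2})b\neq\emptyset$;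 and (ii) for all $k\in\mathbb{N}$ and all injective $a\in B^k$, $\operatorname{Aut}(\mathfrak{B}^{\tau_1})a\cap\operatorname{Aut}(\mathfrak{B}^{\tau_2})a=\operatorname{Aut}(\mathfrak{B})a$. A structure $\mathfrak{B}$ does not have algebraicity if for every first-order formula $\phi(x_0,x_1,\dots,x_n)$ and all $a_1,\dots,a_n\in B$ the set $\{a_0\in B\mid \mathfrak{B}\models\phi(a_0,a_1,\dots,a_n)\}$ is either infinite or contained in $\{a_1,\dots,a_n\}$; otherwise it has algebraicity. A permutation group $G$ on $A$ is $n$-transitive if for all injective $b,c\in A^n$ there is $g\in G$ with $g(b)=c$ (componentwise). *)

(* Defs.v *)
From HB Require Import structures.
From mathcomp Require Import all_boot.
From mathcomp Require Import boolp classical_sets functions cardinality.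

Set Implicit Arguments.
Unset Strict Implicit.
Unset Printing Implicit Defensive.

Local Open Scope classical_set_scope.
Local Open Scope card_scope.

(* A countable relational signature; arity 0 is allowed. *)
Record signature := Signature {
  symbol : countType;
  arity : symbol -> nat
}.

Record structure (tau : signature) := Structure {
  dom :> Type;
  interp : forall r : symbol tau, (arity r).-tuple dom -> Prop
}.
Arguments Structure {tau dom}.

Definition injective_tuple (T : Type) (n : nat) (a : n.-tuple T) : Prop :=
  injective (tnth a).

(* First-order formulas with equality whose free variables are among the n
   variables 'I_n, in de Bruijn style: [fall] binds the variable 0 and shifts
   the others by one. The connectives left out (negation, conjunction,
   existential quantification, ...) are classically definable. *)
Inductive formula (tau : signature) (n : nat) : Type :=
| ffalse
| feq of 'I_n & 'I_n
| frel (r : symbol tau) of (arity r).-tuple 'I_n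
| fimp of formula tau n & formula tau n
| fall of formula tau n.+1.
Arguments ffalse {tau n}.
Arguments feq {tau n}.
Arguments frel {tau n}.

Definition sentence (tau : signature) : Type := formula tau 0.

Fixpoint sat (tau : signature) (B : structure tau) (n : nat)
    (phi : formula tau n) : n.-tuple B -> Prop :=
  match phi with
  | ffalse => fun=> False
  | feq i j => fun a => tnth a i = tnth a j
  | frel r v => fun a => interp (map_tuple (tnth a) v)
  | fimp phi1 phi2 => fun a => sat phi1 a -> sat phi2 a
  | fall psi => fun a => forall x : B, sat psi (cons_tuple x a)
  end.

Definition Th (tau : signature) (B : structure tau) : set (sentence tau) :=
  [set phi | sat phi ([tuple] : 0.-tuple B)].

Definition is_model (tau : signature) (T : set (sentence tau))
  (B : structure tau) : Prop := T `<=` Th B.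

Definition is_isomorphism (tau : signature) (A B : structure tau)
    (f : A -> B) : Prop :=
  bijective f /\
  forall (r : symbol tau) (a : (arity r).-tuple A),
    interp a <-> interp (map_tuple f a).

Definition isomorphic (tau : signature) (A B : structure tau) : Prop :=
  exists f : A -> B, is_isomorphism f.

Definition omega_categorical_theory (tau : signature)
    (T : set (sentence tau)) : Prop :=
  exists A : structure tau,
    [/\ countable [set: A], is_model T A &
      forall B : structure tau,
        countable [set: B] -> is_model T B -> isomorphic A B].

Definition omega_categorical (tau : signature) (B : structure tau) : Prop :=
  omega_categorical_theory (Th B).

Definition countably_infinite (T : Type) : Prop := [set: T] #= [set: nat].

Definition Aut (tau : signature) (B : structure tau) : set (B -> B) :=
  [set f | is_isomorphism f].
Arguments Aut {tau} B.

Definition tuple_orbit (T : Type) (G : set (T -> T)) (n : nat)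
    (a : n.-tuple T) : set (n.-tuple T) :=
  [set map_tuple g a | g in G].

Definition n_transitive (T : Type) (G : set (T -> T)) (n : nat) : Prop :=
  forall b c : n.-tuple T, injective_tuple b -> injective_tuple c ->
    exists2 g, G g & map_tuple g b = c.

Definition no_algebraicity (tau : signature) (B : structure tau) : Prop :=
  forall (n : nat) (phi : formula tau n.+1) (a : n.-tuple B),
    let S := [set a0 : B | sat phi (cons_tuple a0 a)] in
    infinite_set S \/ S `<=` range (tnth a).

Definition has_algebraicity (tau : signature) (B : structure tau) : Prop :=
  ~ no_algebraicity B.

(* The union of two disjoint signatures is the sum of their symbol types. *)
Definition sig_union (tau1 tau2 : signature) : signature :=
  {| symbol := (symbol tau1 + symbol tau2)%type;
     arity := fun r => match r with inl r1 => arity r1 | inr r2 => arity r2 end |}.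

Definition reductl (tau1 tau2 : signature)
    (B : structure (sig_union tau1 tau2)) : structure tau1 :=
  Structure (fun r : symbol tau1 => @interp _ B (inl r)).

Definition reductr (tau1 tau2 : signature)
    (B : structure (sig_union tau1 tau2)) : structure tau2 :=
  Structure (fun r : symbol tau2 => @interp _ B (inr r)).

(* The inclusions of tau1- and tau2-formulas in (tau1 u tau2)-formulas. *)
Fixpoint formulal (tau1 tau2 : signature) (n : nat) (phi : formula tau1 n) :
    formula (sig_union tau1 tau2) n :=
  match phi with
  | ffalse => ffalse
  | feq i j => feq i j
  | frel r v => @frel (sig_union tau1 tau2) n (inl r) v
  | fimp phi1 phi2 => fimp (formulal tau2 phi1) (formulal tau2 phi2)
  | fall psi => fall (formulal tau2 psi)
  end.

Fixpoint formular (tau1 tau2 : signature) (n : nat) (phi : formula tau2 n) :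
    formula (sig_union tau1 tau2) n :=
  match phi with
  | ffalse => ffalse
  | feq i j => feq i j
  | frel r v => @frel (sig_union tau1 tau2) n (inr r) v
  | fimp phi1 phi2 => fimp (formular tau1 phi1) (formular tau1 phi2)
  | fall psi => fall (formular tau1 psi)
  end.

Definition is_generic_combination (tau1 tau2 : signature)
    (B1 : structure tau1) (B2 : structure tau2)
    (B : structure (sig_union tau1 tau2)) : Prop :=
  [/\ countably_infinite B,
      is_model ((formulal tau2 (n := 0) @` Th B1)
                `|` (formular tau1 (n := 0) @` Th B2)) B,
      forall (k : nat) (a b : k.-tuple B),
        injective_tuple a -> injective_tuple b ->
        tuple_orbit (Aut (reductl B)) a
          `&` tuple_orbit (Aut (reductr B)) b !=set0 &
      forall (k : nat) (a : k.-tuple B),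
        injective_tuple a ->
        tuple_orbit (Aut (reductl B)) a
          `&` tuple_orbit (Aut (reductr B)) a
        = tuple_orbit (Aut B) a].

(* Main.v *)
(* A generic combination is a pair of structures on one carrier, i.e. a bijection
   [pi] between the two domains.  Both conditions on it follow from the one-point
   property [free_extensions]: a point outside a tuple can realise any orbit of
   the first stabiliser together with any orbit of the second.  If all these
   orbits are infinite, a generic [pi] has the property.  They are infinite
   because, by the omitting types theorem, every tuple of a countable
   omega-categorical structure has an isolated type, so that the orbits of
   stabilisers are definable and the absence of algebraicity applies.  If one
   structure is highly transitive, every permutation is an automorphism of it and
   any [pi] works.

   Conversely, let [f] enumerate a finite set invariant under the stabiliser of
   [a] in the first group.  By independence of the two groups, an enumeration [z]
   of as many points outside a tuple [t], and any variant of [z] through a given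
   point [w], are both realised as positions of [f] over the same [a], up to an
   automorphism of the combination; so the orbit of [w] over [t] in the second
   group meets every such [z].  Hence orbits over [t] are cofinite, and there is
   only one. *)

Require Import Defs.
From Stdlib Require List.
From mathcomp Require Import all_boot.
From mathcomp Require Import boolp classical_sets functions cardinality.

Set Implicit Arguments.
Unset Strict Implicit.
Unset Printing Implicit Defensive.

Local Open Scope classical_set_scope.
Local Open Scope card_scope.

(** * Countable sets, generic chains and back-and-forth *)

Lemma countable_injective (T : Type) :
  countable [set: T] -> exists c : T -> nat, injective c.
Proof.
by case/countable_injP => c cI; exists c => x y; apply: cI; rewrite inE.
Qed.

Lemma inj_countable (T : Type) (U : countType) (f : T -> U) :
  injective f -> countable [set: T].
Proof.
move=> fI; apply/countable_injP; exists (pickle \o f).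
by move=> x y _ _ /(pcan_inj pickleK)/fI.
Qed.

Lemma prod_countable (A B : Type) :
  countable [set: A] -> countable [set: B] -> countable [set: A * B].
Proof. by move=> cA cB; rewrite -setXTT; exact: countableX. Qed.

Lemma sum_countable (A B : Type) :
  countable [set: A] -> countable [set: B] -> countable [set: A + B].
Proof.
move=> /countable_injective[f fI] /countable_injective[g gI].
apply: (@inj_countable _ _ (fun x => match x with
  inl a => inl (f a) | inr b => inr (g b) end : nat + nat)).
by move=> [a|b] [a'|b'] // [] => [/fI|/gI] ->.
Qed.

Lemma seq_countable (A : Type) :
  countable [set: A] -> countable [set: seq A].
Proof.
by move=> /countable_injective[f fI]; exact: (inj_countable (inj_map fI)).
Qed.

(** The step after stage [n] enters [D i] for the one index with code [n], if there is one, and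
    otherwise stays put. *)
Lemma rasiowa_sikorski (P I : Type) (le : P -> P -> Prop)
    (D : I -> P -> Prop) (p0 : P) :
  (forall p, le p p) -> (forall q p r, le p q -> le q r -> le p r) ->
  countable [set: I] -> (forall i p, exists q, le p q /\ D i q) ->
  exists s : nat -> P, [/\ s 0 = p0,
    forall m n, m <= n -> le (s m) (s n) & forall i, exists n, D i (s n)].
Proof.
move=> lexx le_trans /countable_injective[c cI] dense.
have step (np : nat * P) : exists q,
    le np.2 q /\ forall i, c i = np.1 -> D i q.
  have [[i ci]|noi] := pselect (exists i, c i = np.1).
    have [q [pq Dq]] := dense i np.2.
    by exists q; split=> // j; rewrite -ci => /cI ->.
  by exists np.2; split=> // i ci; case: noi; exists i.
have [f fP] := choice step.
pose s := fix s n := if n is m.+1 then f (m, s m) else p0.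
exists s; split=> // [m n /subnK <-|i].
  elim: (n - m) => [|k IH] //=; apply: le_trans IH _.
  exact: (fP (k + m, s (k + m))).1.
by exists (c i).+1; apply: (fP (c i, s (c i))).2.
Qed.

(** The union of a chain of good lists meeting every domain, range and [D] requirement is the graph
    of a bijection. Finitely many points are covered at one stage, so properties that involve
    finitely many points pass from good lists to [f]. *)
Lemma back_and_forth (A B I : Type)
    (good : seq (A * B) -> Prop) (D : I -> seq (A * B) -> Prop)
    (s0 : seq (A * B)) :
  countable [set: A] -> countable [set: B] -> countable [set: I] ->
  (forall s, good s -> forall p q, List.In p s -> List.In q s ->
     p.1 = q.1 <-> p.2 = q.2) ->
  (forall s a, good s -> exists b, good ((a, b) :: s)) ->
  (forall s b, good s -> exists a, good ((a, b) :: s)) ->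
  (forall i s, good s -> exists t, good (t ++ s) /\ D i (t ++ s)) ->
  good s0 ->
  exists f : A -> B, [/\ bijective f,
    forall p, List.In p s0 -> f p.1 = p.2,
    forall l : seq A, exists2 s, good s &
      forall a, List.In a l -> List.In (a, f a) s &
    forall i, exists2 s, good s /\ D i s & forall p, List.In p s -> f p.1 = p.2].
Proof.
move=> cA cB cI inj forth back dense good0.
pose P := {s | good s}.
pose le (s t : P) := forall p, List.In p (sval s) -> List.In p (sval t).
pose E (j : A + B + I) (s : P) := match j with
  | inl (inl a) => exists b, List.In (a, b) (sval s)
  | inl (inr b) => exists a, List.In (a, b) (sval s)
  | inr i => D i (sval s) end.
have cABI : countable [set: A + B + I].
  exact/sum_countable/cI/sum_countable.
have [||||s [s_0 s_mono s_meet]] :=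
  @rasiowa_sikorski P _ le E (exist _ s0 good0) => //.
- by move=> p x.
- by move=> q p r pq qr x /pq /qr.
- move=> [[a|b]|i] [s gs].
  + have [b gb] := forth s a gs; exists (exist _ _ gb); split=> [x|] /=.
      by right.
    by exists b; left.
  + have [a ga] := back s b gs; exists (exist _ _ ga); split=> [x|] /=.
      by right.
    by exists a; left.
  + have [t [gt Dt]] := dense i s gs; exists (exist _ _ gt); split=> //= x xs.
    by apply/List.in_or_app; right.
have common m n p q : List.In p (sval (s m)) -> List.In q (sval (s n)) ->
    p.1 = q.1 <-> p.2 = q.2.
  move=> ps qs; apply: (inj _ (svalP (s (maxn m n))) p q).
    by apply: s_mono ps; rewrite leq_maxl.
  by apply: s_mono qs; rewrite leq_maxr.
have total a : exists b, exists n, List.In (a, b) (sval (s n)).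
  by have [n [b H]] := s_meet (inl (inl a)); exists b, n.
have surj b : exists a, exists n, List.In (a, b) (sval (s n)).
  by have [n [a H]] := s_meet (inl (inr b)); exists a, n.
have [f fP] := choice total; have [g gP] := choice surj.
have graph n p : List.In p (sval (s n)) -> f p.1 = p.2.
  by move=> H; have [m Hm] := fP p.1; exact: (common _ _ _ _ Hm H).1.
exists f; split.
- exists g => [a|b].
    have [m Hm] := fP a; have [n Hn] := gP (f a).
    exact: (common _ _ _ _ Hn Hm).2.
  by have [n /graph] := gP b.
- by move=> p ps; apply: (graph 0); rewrite s_0.
- move=> l; suff [n Hn] : exists n, forall a, List.In a l ->
      List.In (a, f a) (sval (s n)) by exists (sval (s n)) => //; exact: svalP.
  elim: l => [|a l [n IH]]; first by exists 0.
  have [m Hm] := fP a; exists (maxn m n) => a' /= [<-|/IH].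
    by apply: s_mono Hm; rewrite leq_maxl.
  by apply: s_mono; rewrite leq_maxr.
- move=> i; have [n Hn] := s_meet (inr i).
  by exists (sval (s n)); [split=> //; exact: svalP|exact: graph].
Qed.

(** * Isomorphisms and formulas *)

Lemma iso_id (tau : signature) (A : structure tau) :
  is_isomorphism (id : A -> A).
Proof.
split=> [|r a]; first by exists id.
suff -> : map_tuple id a = a by [].
by apply: val_inj; rewrite /= map_id.
Qed.

Lemma iso_comp (tau : signature) (A B C : structure tau) (g : B -> C)
    (f : A -> B) :
  is_isomorphism f -> is_isomorphism g -> is_isomorphism (g \o f).
Proof.
move=> [fB fP] [gB gP]; split=> [|r a]; first exact: bij_comp.
have -> : map_tuple (g \o f) a = map_tuple g (map_tuple f a).
  by apply: val_inj; rewrite /= map_comp.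
by rewrite fP gP.
Qed.

Lemma iso_can (tau : signature) (A B : structure tau) (f : A -> B)
    (g : B -> A) :
  is_isomorphism f -> cancel f g -> cancel g f -> is_isomorphism g.
Proof.
move=> [fB fP] fK gK; split=> [|r a]; first by exists f.
rewrite fP; suff -> : map_tuple f (map_tuple g a) = a by [].
by apply: val_inj; rewrite /= mapK.
Qed.

Lemma iso_inv (tau : signature) (A B : structure tau) (f : A -> B) :
  is_isomorphism f ->
  exists g : B -> A, [/\ is_isomorphism g, cancel f g & cancel g f].
Proof.
move=> fi; have [[g fK gK] _] := fi.
by exists g; split=> //; exact: iso_can fi fK gK.
Qed.

Lemma map_tuple_cons (S T : Type) (f : S -> T) n x (a : n.-tuple S) :
  map_tuple f (cons_tuple x a) = cons_tuple (f x) (map_tuple f a).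
Proof. exact: val_inj. Qed.

Lemma sat_iso (tau : signature) (A B : structure tau) (f : A -> B) n
    (phi : formula tau n) (a : n.-tuple A) :
  is_isomorphism f -> sat phi (map_tuple f a) <-> sat phi a.
Proof.
move=> [fB fP]; elim: phi a => {n} [n|n i j|n r v|n p IHp q IHq|n p IH] a //=.
- by rewrite !tnth_map; split=> [/(bij_inj fB)|->].
- suff -> : map_tuple (tnth (map_tuple f a)) v =
            map_tuple f (map_tuple (tnth a) v) by rewrite -fP.
  apply: val_inj; rewrite /= -map_comp; apply: eq_map => i /=.
  by rewrite tnth_map.
- by rewrite IHp IHq.
- have [g fK gK] := fB; split=> H x.
    by apply/IH; rewrite map_tuple_cons; apply: H.
  by rewrite -(gK x) -map_tuple_cons; apply/IH/H.
Qed.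

(** * Renaming and coding of formulas *)

Definition lift_renaming n m (f : 'I_n -> 'I_m) (i : 'I_n.+1) : 'I_m.+1 :=
  if unlift ord0 i is Some j then lift ord0 (f j) else ord0.

Fixpoint rename (tau : signature) n (phi : formula tau n) :
    forall m, ('I_n -> 'I_m) -> formula tau m :=
  match phi with
  | ffalse => fun _ _ => ffalse
  | feq i j => fun _ f => feq (f i) (f j)
  | Defs.frel r v => fun _ f => Defs.frel r (map_tuple f v)
  | fimp p q => fun _ f => fimp (rename p f) (rename q f)
  | fall p => fun _ f => fall (rename p (lift_renaming f))
  end.

Lemma sat_rename (tau : signature) (B : structure tau) n (phi : formula tau n)
    m (f : 'I_n -> 'I_m) (a : m.-tuple B) :
  sat (rename phi f) a <-> sat phi [tuple tnth a (f i) | i < n].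
Proof.
elim: phi m f a => {n} [n|n i j|n r v|n p IHp q IHq|n p IH] m f a //=.
- by rewrite !tnth_mktuple.
- suff -> : map_tuple (tnth a) (map_tuple f v) =
            map_tuple (tnth [tuple tnth a (f i) | i < n]) v by [].
  apply: val_inj; rewrite /= -map_comp; apply: eq_map => i /=.
  by rewrite tnth_mktuple.
- by rewrite IHp IHq.
- have E x : [tuple tnth (cons_tuple x a) (lift_renaming f i) | i < n.+1] =
             cons_tuple x [tuple tnth a (f i) | i < n].
    apply: eq_from_tnth => i; rewrite tnth_mktuple /lift_renaming.
    by case: unliftP => [j|] ->; rewrite ?tnth0 // !tnthS tnth_mktuple.
  by split=> H x; have := H x; rewrite IH E.
Qed.

(** The untyped code forgets the number of free variables, which a quantifier changes, yet is
    injective for each fixed number. It makes the Henkin requirements countable. *)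
Fixpoint formula_code (tau : signature) n (phi : formula tau n) :
    GenTree.tree nat :=
  match phi with
  | ffalse => GenTree.Node 0 [::]
  | feq i j => GenTree.Node 1 [:: GenTree.Leaf (val i); GenTree.Leaf (val j)]
  | Defs.frel r v => GenTree.Node 2
      (GenTree.Leaf (pickle r) :: [seq GenTree.Leaf (val i) | i <- v])
  | fimp p q => GenTree.Node 3 [:: formula_code p; formula_code q]
  | fall p => GenTree.Node 4 [:: formula_code p]
  end.

Lemma formula_code_inj (tau : signature) n :
  injective (@formula_code tau n).
Proof.
move=> phi; elim: phi => {n} [n|n i j|n r v|n p IHp q IHq|n p IH]
  [|i' j'|r' v'|p' q'|p'] //= [].
- by move=> /val_inj -> /val_inj ->.
- move=> /(pcan_inj pickleK) rr'; case: r' / rr' v' => v' /inj_map vv'.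
  by congr Defs.frel; apply: val_inj; apply: vv' => i i' [] /val_inj.
- by move=> /IHp -> /IHq ->.
- by move=> /IH ->.
Qed.

(** * Definable relations and their closure properties *)

Definition definable (tau : signature) (B : structure tau) n
    (S : n.-tuple B -> Prop) : Prop :=
  exists phi : formula tau n, forall a, sat phi a <-> S a.

Lemma definable_imp (tau : signature) (B : structure tau) n
    (S R : n.-tuple B -> Prop) :
  definable S -> definable R -> definable (fun a => S a -> R a).
Proof.
by move=> [p pP] [q qP]; exists (fimp p q) => a /=; rewrite pP qP.
Qed.

Lemma definable_not (tau : signature) (B : structure tau) n
    (S : n.-tuple B -> Prop) :
  definable S -> definable (fun a => ~ S a).
Proof. by move=> dS; apply: (definable_imp dS); exists ffalse. Qed.

Lemma definable_ext (tau : signature) (B : structure tau) n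
    (R S : n.-tuple B -> Prop) :
  definable R -> (forall a, R a <-> S a) -> definable S.
Proof. by move=> [p pP] RS; exists p => a; rewrite pP RS. Qed.

Lemma definable_and (tau : signature) (B : structure tau) n
    (S R : n.-tuple B -> Prop) :
  definable S -> definable R -> definable (fun a => S a /\ R a).
Proof.
move=> dS dR.
apply: (definable_ext (definable_not (definable_imp dS (definable_not dR)))).
move=> a; split=> [H|[Sa Ra] /(_ Sa) //].
by split; apply: contrapT => H'; apply: H => // Sa.
Qed.

Lemma definable_ex (tau : signature) (B : structure tau) n
    (S : n.+1.-tuple B -> Prop) :
  definable S -> definable (fun a => exists x, S (cons_tuple x a)).
Proof.
move=> /definable_not[p pP].
have dA : definable (fun a => forall x, ~ S (cons_tuple x a)).
  by exists (fall p) => a /=; split=> H x; apply/pP/H.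
apply: (definable_ext (definable_not dA)) => a.
by split=> [/existsNP[x /contrapT Sx]|[x Sx] /(_ x)//]; exists x.
Qed.

Lemma definable_ex_tuple (tau : signature) (B : structure tau) k n
    (S : (k + n).-tuple B -> Prop) :
  definable S ->
  definable (fun a => exists z : k.-tuple B, S (cat_tuple z a)).
Proof.
elim: k S => [|k IH] S dS.
  apply: (definable_ext dS) => a.
  have E (z : 0.-tuple B) : cat_tuple z a = a.
    by apply: val_inj; rewrite /= tuple0.
  by split=> [Sa|[z]]; [exists [tuple]; rewrite E|rewrite E].
apply: (definable_ext (IH _ (definable_ex dS))) => a.
have E x (z : k.-tuple B) :
    cons_tuple x (cat_tuple z a) = cat_tuple (cons_tuple x z) a.
  exact: val_inj.
split=> [[z [x Sx]]|[z]]; first by exists (cons_tuple x z); rewrite -E.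
by case/tupleP: z => x z Sx; exists z, x; rewrite E.
Qed.

Lemma definable_reindex (tau : signature) (B : structure tau) n m
    (f : 'I_n -> 'I_m) (S : n.-tuple B -> Prop) :
  definable S -> definable (fun a => S [tuple tnth a (f i) | i < n]).
Proof.
by move=> [p pP]; exists (rename p f) => a; rewrite sat_rename pP.
Qed.

Lemma definable_all (tau : signature) (B : structure tau) n (I : finType)
    (S : I -> n.-tuple B -> Prop) :
  (forall i, definable (S i)) -> definable (fun a => forall i, S i a).
Proof.
move=> dS.
suff dl (l : seq I) : definable (fun a => forall i, i \in l -> S i a).
  apply: (definable_ext (dl (enum I))) => a.
  by split=> H i; [apply: H; rewrite mem_enum|move=> _; apply: H].
elim: l => [|i l IH].
  by exists (fimp ffalse ffalse) => a /=; split.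
apply: (definable_ext (definable_and (dS i) IH)) => a.
split=> [[Si Sl] j|H]; first by rewrite inE => /predU1P[->|/Sl].
by split=> [|j jl]; apply: H; rewrite inE ?eqxx // jl orbT.
Qed.

Lemma mktuple_lshift (T : Type) n m (z : n.-tuple T) (a : m.-tuple T) :
  [tuple tnth (cat_tuple z a) (lshift m i) | i < n] = z.
Proof. by apply: eq_from_tnth => i; rewrite tnth_mktuple tnth_lshift. Qed.

Lemma mktuple_rshift (T : Type) n m (z : n.-tuple T) (a : m.-tuple T) :
  [tuple tnth (cat_tuple z a) (rshift n i) | i < m] = a.
Proof. by apply: eq_from_tnth => i; rewrite tnth_mktuple tnth_rshift. Qed.

Lemma map_tuple_cat (S T : Type) (f : S -> T) n m (a : n.-tuple S)
    (b : m.-tuple S) :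
  map_tuple f (cat_tuple a b) = cat_tuple (map_tuple f a) (map_tuple f b).
Proof. by apply: val_inj; rewrite /= map_cat. Qed.

(* Sets of valuations of countably many constants defined by one formula: the
   conditions of the Henkin construction below. *)
Definition valuation_definable (tau : signature) (B : structure tau)
    (U : set (nat -> B)) : Prop :=
  exists n (d : n.-tuple nat) (phi : formula tau n),
    forall e, U e <-> sat phi (map_tuple e d).

Lemma valuation_definable_and (tau : signature) (B : structure tau)
    (U : set (nat -> B)) m (d : m.-tuple nat) (phi : formula tau m) :
  valuation_definable U ->
  valuation_definable (fun e => U e /\ sat phi (map_tuple e d)).
Proof.
move=> [n [d' [psi psiP]]]; exists (n + m), (cat_tuple d' d).
have dphi : definable (fun a : m.-tuple B => sat phi a) by exists phi.
have dpsi : definable (fun a : n.-tuple B => sat psi a) by exists psi.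
have [p pP] := definable_and (definable_reindex (@lshift n m) dpsi)
                             (definable_reindex (@rshift n m) dphi).
exists p => e.
by rewrite pP map_tuple_cat mktuple_lshift mktuple_rshift psiP.
Qed.

(** Only finitely many constants occur in the definition of [U] and in [d]; any larger [j] can be
    reassigned freely. *)
Lemma valuation_definable_fresh (tau : signature) (B : structure tau)
    (U : set (nat -> B)) m (d : m.-tuple nat) :
  valuation_definable U ->
  exists2 j, j \notin d &
    forall e x, U e -> U (fun i => if i == j then x else e i).
Proof.
move=> [n [d' [psi psiP]]].
pose j := (\max_(i <- d' ++ d) i).+1.
have jP : j \notin d' ++ d.
  by apply/negP => jd;
  have := @leq_bigmax_seq _ _ predT id _ jd isT; rewrite ltnn.
move: jP; rewrite mem_cat negb_or => /andP[jd' jd]; exists j => // e x.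
rewrite !psiP; congr sat; apply: eq_from_tnth => i; rewrite !tnth_map.
by case: eqP => // ij; move: jd'; rewrite -ij mem_tnth.
Qed.

Lemma valuation_exists (T : Type) (x0 : T) n (d : n.-tuple nat)
    (w : n.-tuple T) :
  (forall i j, tnth d i = tnth d j -> tnth w i = tnth w j) ->
  exists e, map_tuple e d = w.
Proof.
move=> H; have /choice[e eP] : forall k, exists x,
    forall i, tnth d i = k -> tnth w i = x.
  move=> k; have [[i <-]|nk] := pselect (exists i, tnth d i = k).
    by exists (tnth w i) => j /H.
  by exists x0 => i di; case: nk; exists i.
by exists e; apply: eq_from_tnth => i; rewrite tnth_map -(eP _ i).
Qed.

(** The values of the constants in the definition of [U] are quantified away. As constants may be
    repeated, within a list or across the two, the coincidences [dE] that this forces between values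
    are added as a conjunct. *)
Lemma valuation_definable_image (tau : signature) (B : structure tau) (x0 : B)
    (U : set (nat -> B)) m (d : m.-tuple nat) :
  valuation_definable U ->
  definable (fun a : m.-tuple B => exists2 e, U e & map_tuple e d = a).
Proof.
move=> [n [d' [psi psiP]]].
have dpsi : definable (fun a : n.-tuple B => sat psi a) by exists psi.
pose d'd := cat_tuple d' d.
have dE : definable (fun w : (n + m).-tuple B =>
    forall ij : 'I_(n + m) * 'I_(n + m), tnth d'd ij.1 = tnth d'd ij.2 ->
      tnth w ij.1 = tnth w ij.2).
  apply: definable_all => -[i j] /=.
  have [->|ne] := pselect (tnth d'd i = tnth d'd j).
    by exists (feq i j) => a /=; split=> // ->.
  by exists (fimp ffalse ffalse) => a /=; split.
apply: (definable_ext (definable_ex_tuple (definable_and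
          (definable_reindex (@lshift n m) dpsi) dE))) => a.
split=> [[z []]|[e Ue <-]].
  rewrite mktuple_lshift => psiz E.
  have [|e eP] := @valuation_exists B x0 _ d'd (cat_tuple z a).
    by move=> i j; exact: (E (i, j)).
  rewrite map_tuple_cat in eP.
  exists e.
    apply/psiP; move: psiz; congr sat.
    by rewrite -(mktuple_lshift z a) -eP mktuple_lshift.
  by rewrite -(mktuple_rshift z a) -eP mktuple_rshift.
exists (map_tuple e d'); split; first by rewrite mktuple_lshift; apply/psiP.
by move=> -[i j] /=; rewrite -map_tuple_cat !tnth_map => ->.
Qed.

(** * Omitting types *)

(* [U] plays the role of a complete Henkin theory with constants in [nat]: a
   formula about constants belongs to it when it holds on some [U s]. *)
Definition forced (tau : signature) (B : structure tau)
    (U : nat -> set (nat -> B)) n (phi : formula tau n)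
    (d : n.-tuple nat) : Prop :=
  exists s, forall e, U s e -> sat phi (map_tuple e d).

(** The term model: constants modulo forced equality. The third hypothesis supplies both
    completeness and Henkin witnesses, from which the truth lemma follows by induction on [phi]. *)
Lemma henkin_model (tau : signature) (B : structure tau)
    (U : nat -> set (nat -> B)) :
  (forall m n, m <= n -> U n `<=` U m) -> (forall n, U n !=set0) ->
  (forall n (phi : formula tau n.+1) (d : n.-tuple nat),
     forced U (fall phi) d \/
     exists j, forced U (fimp phi ffalse) (cons_tuple j d)) ->
  exists (M : structure tau) (cls : nat -> M),
    (forall m, exists i, cls i = m) /\
    forall n (phi : formula tau n) d,
      sat phi (map_tuple cls d) <-> forced U phi d.
Proof.
move=> U_dec U_ne henkin.
have forced2 n m (phi : formula tau n) (psi : formula tau m) d d' :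
    forced U phi d -> forced U psi d' -> exists s, forall e, U s e ->
      sat phi (map_tuple e d) /\ sat psi (map_tuple e d').
  move=> [s sP] [t tP]; exists (maxn s t) => e Ue.
  by split; [apply/sP/U_dec/Ue/leq_maxl|apply/tP/U_dec/Ue/leq_maxr].
have decide n (phi : formula tau n) d :
    forced U phi d \/ forced U (fimp phi ffalse) d.
  have E e i : [tuple tnth (map_tuple e (cons_tuple i d)) (lift ord0 k) | k < n]
               = map_tuple e d :> n.-tuple B.
    by apply: eq_from_tnth => k; rewrite tnth_mktuple map_tuple_cons tnthS.
  have E' e x : [tuple tnth (cons_tuple x (map_tuple e d)) (lift ord0 k) | k < n]
               = map_tuple e d :> n.-tuple B.
    by apply: eq_from_tnth => k; rewrite tnth_mktuple tnthS.
  (* Quantifying over a variable absent from [phi] turns the Henkin alternative into a decision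
     about [phi] itself. *)
  have [[s sP]|[j [s sP]]] := henkin n (rename phi (lift ord0)) d.
    by left; exists s => e Ue; have /= /(_ (e 0)) := sP e Ue;
      rewrite sat_rename E'.
  by right; exists s => e Ue; have /= := sP e Ue; rewrite sat_rename E.
have consistent n (phi : formula tau n) d :
    forced U phi d -> ~ forced U (fimp phi ffalse) d.
  move=> H H'; have [s sP] := forced2 _ _ _ _ _ _ H H'.
  by have [e /sP[pe /(_ pe)]] := U_ne s.
pose eqv i j := exists s, forall e, U s e -> e i = e j.
have eqv_sym i j : eqv i j -> eqv j i.
  by move=> [s sP]; exists s => e /sP.
have eqv_trans i j k : eqv i j -> eqv j k -> eqv i k.
  move=> [s sP] [t tP]; exists (maxn s t) => e Ue.
  rewrite (sP e); first by apply/tP/U_dec/Ue/leq_maxr.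
  exact/U_dec/Ue/leq_maxl.
pose D := {X : set nat | exists i, X = eqv i}.
pose cls i : D := exist _ (eqv i) (ex_intro _ i erefl).
have cls_surj m : exists i, cls i = m.
  by case: m => X [i Xi]; exists i; exact: eq_exist.
have clsP i j : cls i = cls j <-> eqv i j.
  split=> [/(congr1 sval) /= ij|ij].
    by rewrite ij; exists 0.
  apply: eq_exist; apply/funext => k; apply/propext.
  by split=> [/(eqv_trans _ _ _ (eqv_sym _ _ ij))|/(eqv_trans _ _ _ ij)].
have forced_eqv n (phi : formula tau n) (d d' : n.-tuple nat) :
    map_tuple cls d = map_tuple cls d' -> forced U phi d -> forced U phi d'.
  move=> dd' [s sP].
  have /choice[t tP] : forall i, exists t, forall e, U t e ->
      e (tnth d i) = e (tnth d' i).
    by move=> i; apply/clsP;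
    have := congr1 (fun v => tnth v i) dd'; rewrite !tnth_map.
  (* Each coordinate is identified from its own stage on; past the largest of these stages the two
     tuples have the same values. *)
  exists (maxn s (\max_i t i)) => e Ue.
  suff <- : map_tuple e d = map_tuple e d' by apply/sP/U_dec/Ue/leq_maxl.
  apply: eq_from_tnth => i; rewrite !tnth_map; apply/tP/U_dec/Ue.
  by apply: leq_trans (leq_maxr _ _); exact: leq_bigmax.
have [rep repP] := choice cls_surj.
have map_rep n (d : n.-tuple nat) :
    map_tuple cls (map_tuple rep (map_tuple cls d)) = map_tuple cls d.
  by apply: eq_from_tnth => i; rewrite !tnth_map repP.
(* Relations are read off on chosen representatives; [forced_eqv] makes the choice immaterial. *)
pose M := Structure (fun r (v : (arity r).-tuple D) =>
  forced U (Defs.frel r (ord_tuple _)) (map_tuple rep v)) : structure tau.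
exists M, cls; split=> // n phi.
elim: phi => {n} [n|n i j|n r v|n p IHp q IHq|n p IH] d /=.
- by split=> // -[s sP]; have [e /sP] := U_ne s.
- rewrite !tnth_map clsP /forced /= /eqv.
  by under [in X in _ <-> X]eq_exists do under eq_forall do rewrite !tnth_map.
- pose dv := map_tuple (tnth d) v.
  have -> : map_tuple (tnth (map_tuple cls d)) v = map_tuple cls dv.
    apply: val_inj; rewrite /= -map_comp; apply: eq_map => i /=.
    by rewrite tnth_map.
  have H : forced U (Defs.frel r (ord_tuple _)) dv <->
           forced U (Defs.frel r v) d.
    suff H (e : nat -> B) : map_tuple (tnth (map_tuple e dv)) (ord_tuple _) =
             map_tuple (tnth (map_tuple e d)) v.
      by split=> -[s sP]; exists s => e /sP /=; rewrite H.
    apply: eq_from_tnth => i.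
    by rewrite !tnth_map tnth_ord_tuple.
  by rewrite -H; split; apply: forced_eqv; rewrite map_rep.
- rewrite IHp IHq; split=> [H|H fp].
    have [fp|fnp] := decide n p d.
      by have [s sP] := H fp; exists s => e /sP qe _.
    by have [s sP] := fnp; exists s => e Ue pe; have := sP e Ue pe.
  by have [s sP] := forced2 _ _ _ _ _ _ fp H; exists s => e /sP[/[swap]/[apply]].
- split=> [H|[s sP] m].
    have [//|[j fj]] := henkin n p d; have := H (cls j).
    by rewrite -map_tuple_cons => /IH/consistent.
  have [j <-] := cls_surj m; rewrite -map_tuple_cons; apply/IH.
  by exists s => e Ue; rewrite map_tuple_cons; exact: sP.
Qed.

(** The complete type of [c] over the empty set is principal, generated by [theta]. *)
Definition isolated (tau : signature) (B : structure tau) n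
    (c : n.-tuple B) : Prop :=
  exists2 theta : formula tau n, sat theta c &
    forall b : n.-tuple B, sat theta b ->
      forall phi : formula tau n, sat phi c -> sat phi b.

Lemma isolated_iff (tau : signature) (B : structure tau) n (c b : n.-tuple B) :
  (forall phi : formula tau n, sat phi c -> sat phi b) ->
  forall phi : formula tau n, sat phi c <-> sat phi b.
Proof.
move=> H phi; split=> [/H//|pb]; apply: contrapT => npc.
exact: (H (fimp phi ffalse) npc pb).
Qed.

(** Conditions are nonempty definable sets of valuations. Requirements decide universal formulas
    with witnesses, or keep a tuple of constants from realising the type of [c]. Every element of
    the resulting Henkin model is named by a constant, so the type is omitted. *)
Lemma omitting_types (tau : signature) (B : structure tau) (x0 : B) N
    (c : N.-tuple B) :
  ~ isolated c ->
  exists M : structure tau, [/\ countable [set: M], is_model (Th B) M &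
    forall m : N.-tuple M, exists2 theta : formula tau N,
      sat theta c & ~ sat theta m].
Proof.
move=> niso.
pose P := {U : set (nat -> B) | valuation_definable U & U !=set0}.
pose le (U V : P) := s2val V `<=` s2val U.
pose I := ({n : nat & (formula tau n.+1 * n.-tuple nat)%type} +
           N.-tuple nat)%type.
pose D (i : I) (U : P) := match i with
  | inl (existT n (phi, d)) =>
      (forall e, s2val U e -> sat (fall phi) (map_tuple e d)) \/
      exists j, forall e, s2val U e -> ~ sat phi (map_tuple e (cons_tuple j d))
  | inr d => exists2 theta : formula tau N, sat theta c &
      forall e, s2val U e -> ~ sat theta (map_tuple e d) end.
have cI : countable [set: I].
  apply: sum_countable; last exact: countableP.
  pose code (i : {n : nat & (formula tau n.+1 * n.-tuple nat)%type}) :=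
    let: existT n (phi, d) := i in (n, formula_code phi, val d).
  apply: (@inj_countable _ _ code) => -[n [phi d]] [n' [phi' d']] [nn'].
  by case: n' / nn' phi' d' => phi' d' /formula_code_inj -> /val_inj ->.
have U0 : P.
  exists setT; last by exists (fun=> x0).
  by exists 0, [tuple], (fimp ffalse ffalse) => e /=; split.
have dense i U : exists V, le U V /\ D i V.
  case: i U => [[n [phi d]]|d] [U Ud [e0 Ue0]].
    have [H|] := pselect (forall e, U e -> sat (fall phi) (map_tuple e d)).
      by exists (exist2 _ _ U Ud (ex_intro _ e0 Ue0)); split=> //; left.
    move=> /existsNP[e /not_implyP[Ue /existsNP[x nphi]]].
    (* The fresh constant [j] becomes a name for the counterexample [x]. *)
    have [j jd /(_ e x Ue) Ue'] := valuation_definable_fresh d Ud.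
    have Vd := valuation_definable_and (cons_tuple j d) (fimp phi ffalse) Ud.
    have V_ne : (fun e => U e /\
        sat (fimp phi ffalse) (map_tuple e (cons_tuple j d))) !=set0.
      exists (fun i => if i == j then x else e i); split=> //=.
      rewrite map_tuple_cons eqxx; set b := map_tuple _ d.
      suff -> : b = map_tuple e d by [].
      apply: eq_from_tnth => i; rewrite !tnth_map; case: eqP => // ij.
      by move: jd; rewrite -ij mem_tnth.
    exists (exist2 _ _ _ Vd V_ne); split=> [? []//|/=].
    by right; exists j => ? [].
  (* [theta] defines the values of [d] on [U]. If [c] violates it, its negation is in the type of
     [c] and fails throughout [U]. Otherwise, as [theta] does not isolate, some value [b] violates a
     formula of the type, and [U] is cut down to the valuations violating it. *)
  have [theta thetaP] := valuation_definable_image x0 d Ud.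
  have [thc|nthc] := pselect (sat theta c); last first.
    exists (exist2 _ _ U Ud (ex_intro _ e0 Ue0)); split=> //.
    exists (fimp theta ffalse) => //= e Ue nth; apply/nth/thetaP.
    by exists e.
  have [b thb [phi phic nphi]] : exists2 b : N.-tuple B, sat theta b &
      exists2 phi : formula tau N, sat phi c & ~ sat phi b.
    apply: contrapT => H; apply: niso; exists theta => // b thb phi phic.
    by apply: contrapT => nphi; apply: H; exists b => //; exists phi.
  have [e Ue eb] := (thetaP b).1 thb; rewrite -eb in nphi.
  have Vd := valuation_definable_and d (fimp phi ffalse) Ud.
  have V_ne : (fun e => U e /\ sat (fimp phi ffalse) (map_tuple e d)) !=set0.
    by exists e.
  exists (exist2 _ _ _ Vd V_ne); split=> [? []//|/=].
  by exists phi => // ? [].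
have [|U V W UV VW e /VW/UV//|s [_ s_dec s_meet]] :=
  @rasiowa_sikorski P I le D U0 _ _ cI dense.
  by move=> U e.
have [||n phi d|M [cls [cls_surj truth]]] :=
  @henkin_model tau B (fun n => s2val (s n)).
- by move=> m n /s_dec.
- by move=> n; apply: (s2valP' (s n)).
- have [k [H|[j H]]] := s_meet (inl (existT _ n (phi, d))).
    by left; exists k.
  by right; exists j, k.
have nil (T : Type) (f : nat -> T) : map_tuple f [tuple] = [tuple].
  exact: val_inj.
exists M; split=> [|phi Bphi|m].
- have [rep repP] := choice cls_surj.
  by apply: (@inj_countable _ _ rep) => m m' /(congr1 cls); rewrite !repP.
- by rewrite /Th /= -(nil _ cls) truth; exists 0 => e _; rewrite nil.
- have [rep repP] := choice cls_surj.
  have [k [theta thc H]] := s_meet (inr (map_tuple rep m)).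
  exists theta => //; have -> : m = map_tuple cls (map_tuple rep m).
    by apply: eq_from_tnth => i; rewrite !tnth_map repP.
  rewrite truth => -[l Hl].
  have [e Ue] := s2valP' (s (maxn k l)).
  apply: (H e); first exact/s_dec/Ue/leq_maxl.
  exact/Hl/s_dec/Ue/leq_maxr.
Qed.

Lemma omega_categorical_isomorphic (tau : signature) (B M : structure tau) :
  omega_categorical B -> countable [set: B] -> countable [set: M] ->
  is_model (Th B) M -> exists f : B -> M, is_isomorphism f.
Proof.
move=> [A [_ _ Acat]] cB cM BM.
have [f fi] := Acat B cB (fun _ => id); have [g gi] := Acat M cM BM.
have [h [hi _ _]] := iso_inv fi.
by exists (g \o h); exact: iso_comp hi gi.
Qed.

(** A type that is not isolated is omitted in a countable model of the theory; that model is
    isomorphic to [B], and the isomorphism carries [c] to a realisation. *)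
Lemma omega_categorical_isolated (tau : signature) (B : structure tau) (x0 : B)
    n (c : n.-tuple B) :
  omega_categorical B -> countable [set: B] -> isolated c.
Proof.
move=> Bcat cB; apply: contrapT => /(omitting_types x0)[M [cM BM omit]].
have [f fi] := omega_categorical_isomorphic Bcat cB cM BM.
have [theta thc] := omit (map_tuple f c).
by apply; apply/(sat_iso _ _ fi).
Qed.

(** * Automorphisms of atomic structures *)

(** Drawing pairs from [s] in any order and with repetitions makes the property depend only on the
    set of pairs. *)
Definition partial_elementary (tau : signature) (B : structure tau)
    (s : seq (B * B)) : Prop :=
  forall n (phi : formula tau n) (v : n.-tuple (B * B)),
    (forall i, List.In (tnth v i) s) ->
    sat phi (map_tuple fst v) <-> sat phi (map_tuple snd v).

Lemma In_tnth (T : Type) (s : seq T) x :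
  List.In x s -> exists i, tnth (in_tuple s) i = x.
Proof.
elim: s => //= y s IH [->|/IH[i <-]]; first by exists ord0.
by exists (lift ord0 i); rewrite !(tnth_nth x).
Qed.

Lemma tnth_In (T : Type) n (t : n.-tuple T) i : List.In (tnth t i) t.
Proof.
elim: n t i => [|n IH] t i; first by case: i.
case/tupleP: t => x t; case: (unliftP ord0 i) => [j|] ->.
  by right; rewrite tnthS; exact: IH.
by left; rewrite tnth0.
Qed.

(** Any tuple of pairs from [t] is a reindexing of [t], so renaming variables turns its formulas
    into formulas about [t]. *)
Lemma partial_elementaryP (tau : signature) (B : structure tau) n
    (t : n.-tuple (B * B)) :
  partial_elementary t <->
  forall phi : formula tau n,
    sat phi (map_tuple fst t) <-> sat phi (map_tuple snd t).
Proof.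
split=> [pt phi|H m phi v vt]; first by apply: pt => i; exact: tnth_In.
have /choice[f fP] : forall i, exists j, tnth t j = tnth v i.
  move=> i; have [j] := In_tnth (vt i).
  move: (tnth v i) => p jp; exists (cast_ord (size_tuple t) j).
  by rewrite -jp !(tnth_nth p).
have E (S : Type) (g : B * B -> S) :
    map_tuple g v = [tuple tnth (map_tuple g t) (f i) | i < m].
  by apply: eq_from_tnth => i; rewrite tnth_mktuple !tnth_map fP.
by rewrite !E -!sat_rename.
Qed.

Lemma map_swapK (S T : Type) (s : seq (S * T)) :
  [seq (p.2, p.1) | p <- [seq (p.2, p.1) | p <- s]] = s.
Proof. by elim: s => //= -[x y] s ->. Qed.

Lemma partial_elementary_sym (tau : signature) (B : structure tau)
    (s : seq (B * B)) :
  partial_elementary s -> partial_elementary [seq (p.2, p.1) | p <- s].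
Proof.
move=> ps n phi v vs.
have := ps n phi (map_tuple (fun p => (p.2, p.1)) v).
have -> : map_tuple fst (map_tuple (fun p : B * B => (p.2, p.1)) v) =
          map_tuple snd v by apply: val_inj; rewrite /= -map_comp.
have -> : map_tuple snd (map_tuple (fun p : B * B => (p.2, p.1)) v) =
          map_tuple fst v by apply: val_inj; rewrite /= -map_comp.
move=> H; apply: iff_sym; apply: H => i; rewrite tnth_map.
have := vs i; case: (tnth v i) => x y /=.
by move=> /List.in_map_iff[[x' y'] [[<- <-]]].
Qed.

(** Solvability of the formula isolating [a] with the first coordinates is itself a formula, hence
    holds of the second coordinates; by isolation a solution there has the required type. *)
Lemma partial_elementary_forth (tau : signature) (B : structure tau)
    (s : seq (B * B)) (a : B) :
  (forall n (c : n.-tuple B), isolated c) -> partial_elementary s ->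
  exists b, partial_elementary ((a, b) :: s).
Proof.
move=> iso ps; pose t := in_tuple s.
have [theta thc thP] := iso _ (cons_tuple a (map_tuple fst t)).
have [phi phiP] : definable (fun c : (size s).-tuple B =>
    exists x, sat theta (cons_tuple x c)) by apply: definable_ex; exists theta.
have /phiP[b thb] : sat phi (map_tuple snd t).
  by apply/((partial_elementaryP t).1 ps)/phiP; exists a.
exists b; apply/(partial_elementaryP (cons_tuple (a, b) t)) => psi.
by rewrite !map_tuple_cons; apply: isolated_iff => chi; exact: thP.
Qed.

(** Back-and-forth, the back step being the forth step with coordinates swapped. No requirement
    beyond domain and range arises, hence the index type [void]. *)
Lemma partial_elementary_extends (tau : signature) (B : structure tau)
    (s : seq (B * B)) :
  countable [set: B] -> (forall n (c : n.-tuple B), isolated c) ->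
  partial_elementary s ->
  exists2 g, Aut B g & forall p, List.In p s -> g p.1 = p.2.
Proof.
move=> cB iso ps.
have [|||||g [gB gs gl _]] := @back_and_forth B B void
  (@partial_elementary tau B) (fun _ _ => True) s cB cB (countableP _) => //.
- move=> t pt p q pin qin.
  have := pt 2 (feq ord0 ord_max) [tuple p; q].
  rewrite /= !(tnth_nth p.1) /=; apply => i.
  by rewrite (tnth_nth p); case: i => [[|[]]].
- by move=> t a; exact: partial_elementary_forth.
- move=> t b /partial_elementary_sym /(partial_elementary_forth b iso)[a].
  by move=> /partial_elementary_sym /=; rewrite map_swapK => H; exists a.
exists g => //; split=> // r v.
have [t pt tP] := gl v.
have := pt _ (Defs.frel r (ord_tuple _)) (map_tuple (fun x => (x, g x)) v).
have E (c : (arity r).-tuple B) : map_tuple (tnth c) (ord_tuple _) = c.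
  by apply: eq_from_tnth => i; rewrite tnth_map tnth_ord_tuple.
rewrite /= !E.
have -> : map_tuple fst (map_tuple (fun x => (x, g x)) v) = v.
  by apply: val_inj; rewrite /= -map_comp map_id.
have -> : map_tuple snd (map_tuple (fun x => (x, g x)) v) = map_tuple g v.
  by apply: val_inj; rewrite /= -map_comp.
by apply => i; rewrite tnth_map; apply: tP; exact: tnth_In.
Qed.

Lemma finite_In (T : Type) (l : seq T) : finite_set [set x | List.In x l].
Proof.
elim: l => [|y l IH]; first by apply: sub_finite_set (finite_set0 T).
have : finite_set ([set y] `|` [set x | List.In x l]).
  by rewrite finite_setU; split=> //; exact: finite_set1.
by apply: sub_finite_set => x /= [->|]; [left|right].
Qed.

Lemma infinite_fresh (T : Type) (S : set T) (l : seq T) :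
  infinite_set S -> exists2 x, S x & ~ List.In x l.
Proof.
move=> Sinf; have := @infinite_setD _ S _ Sinf (finite_In l).
by move=> /infinite_setN0[x [Sx xl]]; exists x.
Qed.

(** Every solution of the formula isolating [x] with [l] has the type of [x] over [l], so it lies in
    the orbit. The solutions include [x], which is outside [l], so without algebraicity they are
    infinitely many. *)
Lemma infinite_orbit (tau : signature) (B : structure tau) (l : seq B) (x : B) :
  countable [set: B] -> (forall n (c : n.-tuple B), isolated c) ->
  no_algebraicity B -> ~ List.In x l ->
  infinite_set [set y | exists2 g, Aut B g &
    (forall z, List.In z l -> g z = z) /\ g x = y].
Proof.
move=> cB iso noalg xl.
have [theta thx thP] := iso _ (cons_tuple x (in_tuple l)).
have [|H] := noalg _ theta (in_tuple l); last first.
  by have [i _ xi] := H _ thx; case: xl; rewrite -xi;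
    exact: (tnth_In (in_tuple l)).
apply: sub_infinite_set => y thy.
have pe : partial_elementary ((x, y) :: [seq (z, z) | z <- l]).
  have E (f : B * B -> B) : (forall z, f (z, z) = z) ->
      map_tuple f (cons_tuple (x, y) (map_tuple (fun z => (z, z)) (in_tuple l)))
      = cons_tuple (f (x, y)) (in_tuple l).
    move=> fP; apply: val_inj => /=; congr cons; rewrite -map_comp.
    by rewrite -[RHS]map_id; apply: eq_map.
  apply/(partial_elementaryP
    (cons_tuple (x, y) (map_tuple (fun z => (z, z)) (in_tuple l)))) => phi.
  by rewrite !E //; apply: isolated_iff => psi; exact: thP.
have [g gA gP] := partial_elementary_extends cB iso pe.
exists g => //; split=> [z zl|]; last exact: (gP (x, y) (or_introl erefl)).
by apply: (gP (z, z)); right; apply/List.in_map_iff; exists z.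
Qed.

(** * Generic combinations *)

Lemma sat_formulal (tau1 tau2 : signature)
    (B : structure (sig_union tau1 tau2)) n (phi : formula tau1 n)
    (a : n.-tuple B) :
  sat (formulal tau2 phi) a <-> @sat _ (reductl B) _ phi a.
Proof.
elim: phi a => {n} [n|n i j|n r v|n p IHp q IHq|n p IH] a //=.
  by rewrite IHp IHq.
by split=> H x; apply/IH/H.
Qed.

Lemma sat_formular (tau1 tau2 : signature)
    (B : structure (sig_union tau1 tau2)) n (phi : formula tau2 n)
    (a : n.-tuple B) :
  sat (formular tau1 phi) a <-> @sat _ (reductr B) _ phi a.
Proof.
elim: phi a => {n} [n|n i j|n r v|n p IHp q IHq|n p IH] a //=.
  by rewrite IHp IHq.
by split=> H x; apply/IH/H.
Qed.

Lemma Aut_reducts (tau1 tau2 : signature)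
    (B : structure (sig_union tau1 tau2)) (g : B -> B) :
  Aut B g <-> Aut (reductl B) g /\ Aut (reductr B) g.
Proof.
split=> [[gB gP]|[[gB gl] [_ gr]]].
  by split; split=> // r; [exact: (gP (inl r))|exact: (gP (inr r))].
by split=> // -[r|r]; [exact: gl|exact: gr].
Qed.

(** * Combinations obtained from a bijection *)

Definition combine (tau1 tau2 : signature) (B1 : structure tau1)
    (B2 : structure tau2) (pi : B1 -> B2) : structure (sig_union tau1 tau2) :=
  Structure (fun r : symbol (sig_union tau1 tau2) =>
    match r return (@arity (sig_union tau1 tau2) r).-tuple B1 -> Prop with
    | inl r1 => fun a => @interp _ B1 r1 a
    | inr r2 => fun a => @interp _ B2 r2 (map_tuple pi a)
    end).

Lemma combine_reductl (tau1 tau2 : signature) (B1 : structure tau1)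
    (B2 : structure tau2) (pi : B1 -> B2) :
  @is_isomorphism _ (reductl (combine pi)) B1 id.
Proof.
split=> [|r a]; first by exists id.
suff -> : map_tuple id a = a by [].
by apply: val_inj; rewrite /= map_id.
Qed.

Lemma combine_reductr (tau1 tau2 : signature) (B1 : structure tau1)
    (B2 : structure tau2) (pi : B1 -> B2) :
  bijective pi -> @is_isomorphism _ (reductr (combine pi)) B2 pi.
Proof. by move=> piB; split. Qed.

(** Isomorphisms preserve truth, which settles the theories. Only one inclusion of the orbit
    equality remains to be assumed, since an automorphism of [C] is one of both reducts. *)
Lemma is_generic_combinationP (tau1 tau2 : signature) (B1 : structure tau1)
    (B2 : structure tau2) (C : structure (sig_union tau1 tau2))
    (f1 : reductl C -> B1) (f2 : reductr C -> B2) :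
  countably_infinite C -> is_isomorphism f1 -> is_isomorphism f2 ->
  (forall k (a b : k.-tuple C), injective_tuple a -> injective_tuple b ->
     exists g1 g2, [/\ Aut (reductl C) g1, Aut (reductr C) g2 &
       map_tuple g1 a = map_tuple g2 b]) ->
  (forall k (a : k.-tuple C) g1 g2, injective_tuple a ->
     Aut (reductl C) g1 -> Aut (reductr C) g2 ->
     map_tuple g1 a = map_tuple g2 a ->
     exists2 g, Aut C g & map_tuple g a = map_tuple g1 a) ->
  is_generic_combination B1 B2 C.
Proof.
move=> Cinf f1i f2i free amalg; split=> //.
- move=> _ [[phi Bphi <-]|[phi Bphi <-]].
    apply/sat_formulal/(sat_iso _ _ f1i); move: Bphi; congr sat.
    exact: val_inj.
  apply/sat_formular/(sat_iso _ _ f2i); move: Bphi; congr sat.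
  exact: val_inj.
- move=> k a b ai bi; have [g1 [g2 [g1A g2A E]]] := free k a b ai bi.
  by exists (map_tuple g1 a); split; [exists g1|rewrite E; exists g2].
- move=> k a ai; apply/seteqP; split=> [c [[g1 g1A <-] [g2 g2A E]]|c [g gA <-]].
    by have [g gA <-] := amalg k a g1 g2 ai g1A g2A (esym E); exists g.
  by have [gl gr] := (Aut_reducts g).1 gA; split; exists g.
Qed.

Lemma finite_enum (T : Type) (X : set T) :
  finite_set X -> exists n (x : n.-tuple T), injective_tuple x /\
    forall y, X y <-> exists i, tnth x i = y.
Proof.
move=> /(@finite_seqP {classic T})[s ->].
exists (size (undup s)), (in_tuple (undup s)); split=> [|y].
  by rewrite /injective_tuple; apply/(@tuple_uniqP _ {classic T});
    exact: undup_uniq.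
have E z : (z \in in_tuple (undup s)) = (z \in s) by exact: mem_undup.
split=> [ys|[i <-]]; last by rewrite /= -E mem_tnth.
have /tnthP[i ->] : y \in in_tuple (undup s) by rewrite E.
by exists i.
Qed.

(** Preservation of a relation concerns one tuple [v] at a time, and on its entries, listed as [x]
    without repetition, [f] agrees with some automorphism [g]. *)
Lemma highly_transitive_Aut (tau : signature) (B : structure tau)
    (f : B -> B) :
  (forall n, n_transitive (Aut B) n) -> bijective f -> Aut B f.
Proof.
move=> trans fB; split=> // r v.
have [n [x [xI xv]]] := finite_enum
  (@finite_image _ _ setT (tnth v) finite_finset).
have [|g [gB gP] gx] := trans n x (map_tuple f x) xI.
  by move=> i j; rewrite !tnth_map => /(bij_inj fB)/xI.
suff -> : map_tuple f v = map_tuple g v by [].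
apply: eq_from_tnth => i; rewrite !tnth_map.
have [j <-] := (xv (tnth v i)).1 (ex_intro2 _ _ i I erefl).
by have := congr1 (fun t => tnth t j) gx; rewrite !tnth_map => ->.
Qed.

Lemma n_transitive_iso (tau : signature) (A B : structure tau) (f : A -> B) n :
  is_isomorphism f -> n_transitive (Aut B) n -> n_transitive (Aut A) n.
Proof.
move=> fi trans b c bI cI; have [g [gi fK gK]] := iso_inv fi.
have fI := can_inj fK.
have [||h hA hbc] := trans (map_tuple f b) (map_tuple f c).
- by move=> i j; rewrite !tnth_map => /fI/bI.
- by move=> i j; rewrite !tnth_map => /fI/cI.
exists (g \o h \o f); first exact/(iso_comp fi)/(iso_comp hA).
apply: eq_from_tnth => i; move/(congr1 (fun t => tnth t i)): hbc.
by rewrite !tnth_map /= => ->.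
Qed.

Lemma countably_infinite_bijection (S T : Type) :
  countably_infinite S -> countably_infinite T ->
  exists f : S -> T, bijective f.
Proof.
move=> /card_set_bijP[f]; rewrite setTT_bijective => fB.
move=> /card_set_bijP[g]; rewrite setTT_bijective => -[g' gK g'K].
by exists (g' \o f); apply: bij_comp => //; exists g.
Qed.

Lemma highly_transitive_generic_combination (tau1 tau2 : signature)
    (B1 : structure tau1) (B2 : structure tau2) :
  countably_infinite B1 -> countably_infinite B2 ->
  (forall n, n_transitive (Aut B1) n) \/ (forall n, n_transitive (Aut B2) n) ->
  exists C, is_generic_combination B1 B2 C.
Proof.
move=> infB1 infB2 trans.
have [pi piB] := countably_infinite_bijection infB1 infB2.
pose C := combine pi; have C1 := combine_reductl pi.
have C2 := combine_reductr piB; exists C.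
apply: (@is_generic_combinationP _ _ B1 B2 C id pi infB1 C1 C2) => k a.
  move=> b aI bI; case: trans => trans.
    have [g gA gP] := n_transitive_iso C1 (trans k) aI bI.
    exists g, id; split=> //; first exact: (iso_id (reductr C)).
    by rewrite gP; apply: val_inj; rewrite /= map_id.
  have [g gA gP] := n_transitive_iso C2 (trans k) bI aI.
  exists id, g; split=> //.
  by rewrite gP; apply: val_inj; rewrite /= map_id.
move=> g1 g2 aI g1A g2A E; case: trans => trans.
  (* [g2] is a permutation, hence also an automorphism of the highly transitive reduct. *)
  exists g2 => //; apply/Aut_reducts; split=> //.
  apply: (@highly_transitive_Aut _ (reductl C) g2 _ g2A.1) => n.
  exact: (n_transitive_iso C1).
exists g1 => //; apply/Aut_reducts; split=> //.
apply: (@highly_transitive_Aut _ (reductr C) g1 _ g1A.1) => n.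
exact: (n_transitive_iso C2).
Qed.

(** * Free one-point extensions *)

Definition free_extensions (tau1 tau2 : signature)
    (C : structure (sig_union tau1 tau2)) : Prop :=
  forall (l : seq C) x y, ~ List.In x l -> ~ List.In y l ->
    exists g1 g2, [/\ Aut (reductl C) g1, Aut (reductr C) g2,
      forall z, List.In z l -> g1 z = z /\ g2 z = z & g1 x = g2 y].

Lemma injective_tuple_cons (T : Type) n x (a : n.-tuple T) :
  injective_tuple (cons_tuple x a) -> injective_tuple a /\ ~ List.In x a.
Proof.
move=> aI; split=> [i j ij|xa].
  by apply: (@lift_inj _ ord0); apply: aI; rewrite !tnthS.
have [i xi] := In_tnth xa.
have := aI ord0 (lift ord0 (cast_ord (size_tuple a) i)).
rewrite tnth0 tnthS; have -> : tnth a (cast_ord (size_tuple a) i) = x.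
  by rewrite -xi !(tnth_nth x).
by move=> /(_ erefl).
Qed.

(** Induction on the length. The tails are first given a common image; the images of the heads lie
    outside it and are brought together while it stays fixed pointwise. *)
Lemma free_extensions_free (tau1 tau2 : signature)
    (C : structure (sig_union tau1 tau2)) :
  free_extensions C ->
  forall k (a b : k.-tuple C), injective_tuple a -> injective_tuple b ->
    exists g1 g2, [/\ Aut (reductl C) g1, Aut (reductr C) g2 &
      map_tuple g1 a = map_tuple g2 b].
Proof.
move=> free; elim=> [|k IH] a b.
  move=> _ _; exists id, id; split;
    [exact: (iso_id (reductl C))|exact: (iso_id (reductr C))|].
  by rewrite (tuple0 a) (tuple0 b).
case/tupleP: a => x a; case/tupleP: b => y b.
move=> xaI ybI; have [aI xa] := injective_tuple_cons xaI.
have [bI yb] := injective_tuple_cons ybI.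
have [g1 [g2 [g1A g2A E]]] := IH a b aI bI.
have notin (g : C -> C) z (c : k.-tuple C) :
    bijective g -> ~ List.In z c -> ~ List.In (g z) (map_tuple g c).
  by move=> gB zc /List.in_map_iff[z' [/(bij_inj gB) ->]].
have := @free (map_tuple g1 a) (g1 x) (g2 y) (notin _ _ _ g1A.1 xa).
rewrite {1}E => /(_ (notin _ _ _ g2A.1 yb))[h1 [h2 [h1A h2A hl hxy]]].
exists (h1 \o g1), (h2 \o g2); split; [exact: iso_comp|exact: iso_comp|].
rewrite !map_tuple_cons /= hxy; congr cons_tuple.
apply: eq_from_tnth => i; rewrite !tnth_map /=.
have Ei : g1 (tnth a i) = g2 (tnth b i).
  by have := congr1 (fun t => tnth t i) E; rewrite !tnth_map.
have gi : List.In (g1 (tnth a i)) (map_tuple g1 a).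
  by rewrite -[g1 _]tnth_map; exact: tnth_In.
by rewrite (hl _ gi).1 -Ei (hl _ gi).2.
Qed.

(** Back-and-forth with finite partial maps that extend to an automorphism of each reduct, possibly
    different ones. On every finite tuple the limit agrees with automorphisms of both reducts, so it
    is one of both. *)
Lemma free_extensions_amalgam (tau1 tau2 : signature)
    (C : structure (sig_union tau1 tau2)) :
  countable [set: C] -> free_extensions C ->
  forall k (a : k.-tuple C) g1 g2,
    Aut (reductl C) g1 -> Aut (reductr C) g2 ->
    map_tuple g1 a = map_tuple g2 a ->
    exists2 g, Aut C g & map_tuple g a = map_tuple g1 a.
Proof.
move=> cC free k a g1 g2 g1A g2A E.
pose good (s : seq (C * C)) := exists g1 g2, [/\ Aut (reductl C) g1,
  Aut (reductr C) g2 & forall p, List.In p s -> g1 p.1 = p.2 /\ g2 p.1 = p.2].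
have good_sym s : good s -> good [seq (p.2, p.1) | p <- s].
  move=> [h1 [h2 [h1A h2A hs]]].
  have [h1' [h1'A h1K _]] := iso_inv h1A; have [h2' [h2'A h2K _]] := iso_inv h2A.
  exists h1', h2'; split=> // _ /List.in_map_iff[p [<- /hs[e1 e2]]] /=.
  by split; [rewrite -e1 h1K|rewrite -e2 h2K].
have forth s x : good s -> exists y, good ((x, y) :: s).
  move=> [h1 [h2 [h1A h2A hs]]].
  have [[y xy]|xs] := pselect (exists y, List.In (x, y) s).
    by exists y, h1, h2; split=> // p [<-|/hs//]; exact: (hs _ xy).
  have notin (h : C -> C) : bijective h ->
      (forall p, List.In p s -> h p.1 = p.2) -> ~ List.In (h x) (map snd s).
    move=> hB hP /List.in_map_iff[[x' y] /= [yx x's]]; apply: xs; exists y.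
    suff <- : x' = x by [].
    by apply: (bij_inj hB); rewrite (hP _ x's).
  (* The two extensions may send [x] to different points outside the image of [s]; these are moved
     to one point while that image stays fixed. *)
  have [f1 [f2 [f1A f2A fl fxy]]] := free (map snd s) _ _
    (notin _ h1A.1 (fun p ps => (hs p ps).1))
    (notin _ h2A.1 (fun p ps => (hs p ps).2)).
  exists (f1 (h1 x)), (f1 \o h1), (f2 \o h2).
  split; [exact: iso_comp|exact: iso_comp|move=> p [<-|ps] /=].
    by rewrite fxy.
  have [-> ->] := hs p ps; apply: fl; apply/List.in_map_iff.
  by exists p.
have [|||||g [gB gs gl _]] := @back_and_forth C C void good
  (fun _ _ => True) [seq (x, g1 x) | x <- a] cC cC (countableP _) => //.
- move=> s [h1 [h2 [h1A _ hs]]] p q ps qs.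
  have [<- _] := hs p ps; have [<- _] := hs q qs.
  by split=> [->|/(bij_inj h1A.1)].
- move=> s y /good_sym /(forth _ y)[x /good_sym] /=; rewrite map_swapK => H.
  by exists x.
- exists g1, g2; split=> // p /List.in_map_iff[x [<- xa]]; split=> //=.
  have [i <-] := In_tnth xa.
  have := congr1 (fun t => tnth t (cast_ord (size_tuple a) i)) E.
  by rewrite !tnth_map !(tnth_nth x).
have gA : Aut C g.
  apply/Aut_reducts.
  have agree n (v : n.-tuple C) : exists h1 h2, [/\ Aut (reductl C) h1,
      Aut (reductr C) h2, map_tuple g v = map_tuple h1 v &
      map_tuple g v = map_tuple h2 v].
    have [s [h1 [h2 [h1A h2A hs]]] sv] := gl v.
    exists h1, h2; split=> //; apply: eq_from_tnth => i; rewrite !tnth_map;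
      by have [] := hs _ (sv _ (tnth_In v i)).
  split; split=> // r v; have [h1 [h2 [h1A h2A E1 E2]]] := agree _ v.
    by rewrite E1; exact: h1A.2.
  by rewrite E2; exact: h2A.2.
exists g => //; apply: eq_from_tnth => i; rewrite !tnth_map.
apply: (gs (tnth a i, g1 (tnth a i))); apply/List.in_map_iff.
by exists (tnth a i); split=> //; exact: tnth_In.
Qed.

Lemma countably_infinite_infinite (T : Type) :
  countably_infinite T -> infinite_set [set: T].
Proof. by move=> /card_eqPle[_]; rewrite infiniteP. Qed.

Lemma countably_infinite_countable (T : Type) :
  countably_infinite T -> countable [set: T].
Proof. by move=> /card_eqPle[]. Qed.

(** The requirement [D] asks that [pi] match a point of a given orbit on the left with a point of a
    given orbit on the right. Infinite orbits leave any finite list, so one new pair meets each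
    requirement. *)
Lemma free_extensions_exist (tau1 tau2 : signature) (B1 : structure tau1)
    (B2 : structure tau2) :
  countably_infinite B1 -> countably_infinite B2 ->
  (forall (l : seq B1) x, ~ List.In x l -> infinite_set [set y | exists2 g,
     Aut B1 g & (forall z, List.In z l -> g z = z) /\ g x = y]) ->
  (forall (l : seq B2) x, ~ List.In x l -> infinite_set [set y | exists2 g,
     Aut B2 g & (forall z, List.In z l -> g z = z) /\ g x = y]) ->
  exists2 pi : B1 -> B2, bijective pi & free_extensions (combine pi).
Proof.
move=> B1inf B2inf inf1 inf2.
have c1 := countably_infinite_countable B1inf.
have c2 := countably_infinite_countable B2inf.
pose good (s : seq (B1 * B2)) := forall p q, List.In p s -> List.In q s ->
  p.1 = q.1 <-> p.2 = q.2.
pose D (i : seq (B1 * B2) * (B1 * B2)) (s : seq (B1 * B2)) :=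
  ~ List.In i.2.1 (map fst i.1) -> ~ List.In i.2.2 (map snd i.1) ->
  exists h1 h2, [/\ Aut B1 h1, Aut B2 h2,
    forall p, List.In p i.1 -> h1 p.1 = p.1 /\ h2 p.2 = p.2 &
    List.In (h1 i.2.1, h2 i.2.2) s].
have good_cons s x y : good s -> ~ List.In x (map fst s) ->
    ~ List.In y (map snd s) -> good ((x, y) :: s).
  move=> gs xs ys p q [<-|ps] [<-|qs] //=; last exact: gs.
    by split=> E; [case: xs|case: ys]; rewrite E; apply/List.in_map_iff;
      exists q.
  by split=> E; [case: xs|case: ys]; rewrite -E; apply/List.in_map_iff; exists p.
have [||||||pi [piB _ _ pi_meet]] := @back_and_forth B1 B2
  (seq (B1 * B2) * (B1 * B2)) good D [::] c1 c2.
- by apply: prod_countable; [apply: seq_countable|]; exact: prod_countable.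
- by [].
- move=> s x gs; have [[y xy]|xs] := pselect (exists y, List.In (x, y) s).
    by exists y => p q [<-|ps] [<-|qs] //; exact: gs.
  have [y _ ys] := infinite_fresh (map snd s)
    (countably_infinite_infinite B2inf).
  exists y; apply: good_cons => // /List.in_map_iff[[x' y'] /= [xx ps]].
  by apply: xs; exists y'; rewrite -xx.
- move=> s y gs; have [[x xy]|ys] := pselect (exists x, List.In (x, y) s).
    by exists x => p q [<-|ps] [<-|qs] //; exact: gs.
  have [x _ xs] := infinite_fresh (map fst s)
    (countably_infinite_infinite B1inf).
  exists x; apply: good_cons => // /List.in_map_iff[[x' y'] /= [yy ps]].
  by apply: ys; exists x'; rewrite -yy.
- move=> i s gs; have [[xi yi]|nxy] := pselect (~ List.In i.2.1 (map fst i.1) /\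
                                 ~ List.In i.2.2 (map snd i.1)); last first.
    by exists [::]; split=> //= xi yi; case: nxy.
  have [_ [h1 h1A [h1l <-]] h1s] := infinite_fresh (map fst s) (inf1 _ _ xi).
  have [_ [h2 h2A [h2l <-]] h2s] := infinite_fresh (map snd s) (inf2 _ _ yi).
  exists [:: (h1 i.2.1, h2 i.2.2)]; split; first exact: good_cons.
  move=> _ _; exists h1, h2; split=> // [p ps|]; last by left.
  by split; [apply: h1l|apply: h2l]; apply/List.in_map_iff; exists p.
- by [].
exists pi => // l x y xl yl.
(* The requirement is used for the graph of [pi] over [l]; [pi y] is the copy of [y] in [B2]. *)
have [s [_ Ds] spi] := pi_meet ([seq (z, pi z) | z <- l], (x, pi y)).
have [||h1 [h2 [h1A h2A hl hs]]] := Ds.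
- by rewrite -map_comp map_id.
- rewrite -map_comp => /List.in_map_iff[z [/(bij_inj piB) zy zl]].
  by apply: yl; rewrite -zy.
have [pi' piK pi'K] := piB; have pii := combine_reductr piB.
exists h1, (pi' \o h2 \o pi); split=> //.
- exact/(iso_comp pii)/(iso_comp h2A)/(iso_can pii piK pi'K).
- move=> z zl; have [|/= -> ->] := hl (z, pi z); last by rewrite piK.
  by apply/List.in_map_iff; exists z.
- by have /= <- := spi _ hs; rewrite piK.
Qed.

Lemma no_algebraicity_generic_combination (tau1 tau2 : signature)
    (B1 : structure tau1) (B2 : structure tau2) :
  countably_infinite B1 -> countably_infinite B2 ->
  omega_categorical B1 -> omega_categorical B2 ->
  no_algebraicity B1 -> no_algebraicity B2 ->
  exists C, is_generic_combination B1 B2 C.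
Proof.
move=> B1inf B2inf B1cat B2cat noalg1 noalg2.
have c1 := countably_infinite_countable B1inf.
have c2 := countably_infinite_countable B2inf.
have [l x|l x|pi piB free] := free_extensions_exist B1inf B2inf.
- by apply: infinite_orbit => // n c; exact: (omega_categorical_isolated x).
- by apply: infinite_orbit => // n c; exact: (omega_categorical_isolated x).
exists (combine pi).
apply: (@is_generic_combinationP _ _ B1 B2 (combine pi) id pi B1inf
  (combine_reductl pi) (combine_reductr piB)).
  exact: free_extensions_free.
by move=> k a g1 g2 _; exact: free_extensions_amalgam.
Qed.

(** * Algebraicity and transitivity *)

Definition perm_group (T : Type) (G : set (T -> T)) : Prop :=
  [/\ G id, forall f g, G f -> G g -> G (f \o g) &
    forall f, G f -> exists g, [/\ G g, cancel f g & cancel g f]].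

Lemma Aut_perm_group (tau : signature) (B : structure tau) :
  perm_group (Aut B).
Proof.
by split=> [|f g fA gA|f fA]; [exact: iso_id|exact: iso_comp|exact: iso_inv].
Qed.

(** Families over a sum of types act as concatenated tuples, without arithmetic on lengths. *)
Definition fun_sum (T I J : Type) (a : I -> T) (f : J -> T) (k : I + J) : T :=
  match k with inl i => a i | inr j => f j end.

Lemma fun_sum_inj (T I J : Type) (a : I -> T) (f : J -> T) :
  injective a -> injective f -> (forall i j, a i <> f j) ->
  injective (fun_sum a f).
Proof.
move=> aI fI af [i|j] [i'|j'] //=; first by move=> /aI ->.
- by move=> /af.
- by move=> /esym/af.
- by move=> /fI ->.
Qed.

Lemma infinite_inj_fin (T : Type) (S : set T) (J : finType) :
  infinite_set S -> exists2 z : J -> T, injective z & forall j, S (z j).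
Proof.
move=> Sinf; have /choice[F FP] : forall l : seq T, exists x,
    S x /\ ~ List.In x l.
  by move=> l; have [x Sx xl] := infinite_fresh l Sinf; exists x.
pose u := fix u n := if n is m.+1 then F (u m) :: u m else [::].
have u_mono m n : m < n -> List.In (F (u m)) (u n).
  elim: n => // n IH; rewrite ltnS leq_eqVlt => /predU1P[->|/IH]; first by left.
  by right.
exists (fun j => F (u (enum_rank j))) => [j j' E|j]; last first.
  by case: (FP (u (enum_rank j))).
apply/enum_rank_inj/val_inj.
case: (ltngtP (enum_rank j) (enum_rank j')) => // /u_mono.
  by rewrite E => H; case: (FP (u (enum_rank j'))).
by rewrite -E => H; case: (FP (u (enum_rank j))).
Qed.

(** With [amalgamating], this expresses the two conditions on a generic combination for a pair of
    groups, which can then exchange roles. *)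
Definition independent (T : Type) (G1 G2 : set (T -> T)) : Prop :=
  forall (I : finType) (a b : I -> T), injective a -> injective b ->
    exists g1 g2, [/\ G1 g1, G2 g2 & forall i, g1 (a i) = g2 (b i)].

Definition amalgamating (T : Type) (G1 G2 : set (T -> T)) : Prop :=
  forall (I : finType) (a : I -> T) g1 g2, injective a -> G1 g1 -> G2 g2 ->
    (forall i, g1 (a i) = g2 (a i)) ->
    exists h, [/\ G1 h, G2 h & forall i, h (a i) = g1 (a i)].

Definition transitive_off (T : Type) (G : set (T -> T)) (I : finType) : Prop :=
  forall (t : I -> T) x y, injective t -> (forall i, t i <> x) ->
    (forall i, t i <> y) -> exists2 g, G g & (forall i, g (t i) = t i) /\ g x = y.

(* The finite set [f] being invariant under the stabiliser of [a] in [G1], all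
   its possible positions relative to [a] are exhausted by a single enumeration;
   by independence this limits the [G2]-types over [t] which an enumeration of
   #|J| further points can have. *)
Lemma orbit_meets (T : Type) (G1 G2 : set (T -> T)) (I J : finType)
    (a t : I -> T) (f z : J -> T) (j0 : J) (w : T) :
  perm_group G1 -> perm_group G2 -> independent G1 G2 -> amalgamating G1 G2 ->
  injective (fun_sum a f) ->
  (forall g, G1 g -> (forall i, g (a i) = a i) ->
     forall j, exists j', g (f j) = f j') ->
  injective t -> (forall i, t i <> w) -> injective z ->
  (forall i j, t i <> z j) ->
  exists j, exists2 g, G2 g & (forall i, g (t i) = t i) /\ g w = z j.
Proof.
move=> [G1id G1M G1V] [G2id G2M G2V] indep amalg afI af tI tw zI tz.
have [[j zj]|zw] := pselect (exists j, z j = w).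
  by exists j, id; rewrite ?zj.
(* The variant of [z] through [w], injective because [w] is not an entry of [z]. *)
pose z' j := if j == j0 then w else z j.
have z'I : injective z'.
  move=> j j'; rewrite /z'; case: eqP => [->|_]; case: eqP => [->|_] //.
  - by move=> E; case: zw; exists j'.
  - by move=> E; case: zw; exists j.
  - exact: zI.
have tz' i j : t i <> z' j by rewrite /z'; case: ifP => _; [exact: tw|exact: tz].
have [g1 [g2 [g1G g2G E]]] := indep _ _ _ afI (fun_sum_inj tI zI tz).
have [k1 [k2 [k1G k2G E']]] := indep _ _ _ afI (fun_sum_inj tI z'I tz').
have [g1' [g1'G g1K g1'K]] := G1V _ g1G; have [g2' [g2'G g2K g2'K]] := G2V _ g2G.
(* Both maps send [g1 (a i)] to [k1 (a i)], the second by way of [t i]. Their amalgam [h] aligns the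
   two placements of [a]. *)
have [||||h [h1G h2G hP]] := amalg I (g1 \o a) (k1 \o g1') (k2 \o g2').
- move=> i i' /(can_inj g1K) ii'.
  by have := afI (inl i) (inl i') ii'; case.
- exact: G1M.
- exact: G2M.
- move=> i /=; rewrite g1K.
  by rewrite (E (inl i)) /= g2K (E' (inl i)).
have {}hP i : h (g1 (a i)) = k1 (a i) by rewrite hP /= g1K.
have [k1' [k1'G k1K k1'K]] := G1V _ k1G.
have [h' [h'G hK h'K]] := G1V _ h1G.
(* This element of [G1] fixes [a], so it sends [f j0] to some [f j]; the position of [w] is thus the
   image under [h] of that of [z j]. *)
have [|i|j fj] := af (g1' \o h' \o k1) _ _ j0.
- by apply: (G1M) => //; exact: G1M.
- by rewrite /= -hP hK g1K.
have {}fj : h (g1 (f j)) = k1 (f j0) by rewrite -fj /= g1'K h'K.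
have [h'' [h''G hK' h''K]] := G2V _ h2G.
exists j, (g2' \o h'' \o k2); first by apply: (G2M) => //; exact: G2M.
split=> [i|] /=.
  by have /= <- := E' (inl i); rewrite -hP hK'; have /= -> := E (inl i).
have := E' (inr j0); rewrite /= /z' eqxx => <-.
by rewrite -fj hK'; have /= -> := E (inr j).
Qed.

Lemma stabiliser_transitive (T : Type) (G1 G2 : set (T -> T)) (I J : finType)
    (a : I -> T) (f : J -> T) (j0 : J) :
  infinite_set [set: T] ->
  perm_group G1 -> perm_group G2 -> independent G1 G2 -> amalgamating G1 G2 ->
  injective (fun_sum a f) ->
  (forall g, G1 g -> (forall i, g (a i) = a i) ->
     forall j, exists j', g (f j) = f j') ->
  transitive_off G2 I.
Proof.
move=> Tinf G1g G2g indep amalg afI af t x y tI tx ty.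
have [_ G2M G2V] := G2g.
pose orb w := [set v | exists2 g, G2 g & (forall i, g (t i) = t i) /\ g w = v].
(* An infinite set of points off [t] missed by the orbit would contain an enumeration [z]
   contradicting [orbit_meets]. *)
have fin w : (forall i, t i <> w) -> finite_set (~` range t `\` orb w).
  move=> tw; apply: contrapT => /(infinite_inj_fin J)[z zI zP].
  have tz i j : t i <> z j.
    by move=> E; have [+ _] := zP j; apply; exists i.
  have [j Hj] := orbit_meets j0 G1g G2g indep amalg afI af tI tw zI tz.
  by have [_] := zP j.
have : finite_set ((range t `|` (~` range t `\` orb x)) `|`
                   (~` range t `\` orb y)).
  rewrite !finite_setU; split; [split|]; [|exact: fin|exact: fin].
  exact: finite_image finite_finset.
(* Both orbits are cofinite in an infinite domain, so they share a point [v]. *)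
move=> Ffin; have [v [_ vF]] := infinite_setN0 (infinite_setD Tinf Ffin).
have vt : ~ range t v by move=> H; apply: vF; left; left.
have [g gG [gt gx]] : orb x v.
  by apply: contrapT => H; apply: vF; left; right.
have [h hG [ht hy]] : orb y v by apply: contrapT => H; apply: vF; right.
have [h' [h'G hK _]] := G2V _ hG.
exists (h' \o g); first exact: G2M.
by split=> [i|] /=; [rewrite gt -{1}ht hK|rewrite gx -hy hK].
Qed.

(** [stabiliser_transitive] treats only tuples indexed like [a]. Here [a] is padded by fresh points
    indexed by [K], and [t] by points indexed by [I] that avoid [x] and [y], so that both are
    indexed by [I + K]. *)
Lemma stabilisers_transitive (T : Type) (G1 G2 : set (T -> T)) (I J : finType)
    (a : I -> T) (f : J -> T) (j0 : J) :
  infinite_set [set: T] ->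
  perm_group G1 -> perm_group G2 -> independent G1 G2 -> amalgamating G1 G2 ->
  injective (fun_sum a f) ->
  (forall g, G1 g -> (forall i, g (a i) = a i) ->
     forall j, exists j', g (f j) = f j') ->
  forall K : finType, transitive_off G2 K.
Proof.
move=> Tinf G1g G2g indep amalg afI af K t x y tI tx ty.
have [u uI uP] : exists2 u : K -> T, injective u &
    forall k, ~ range (fun_sum a f) (u k).
  apply: (@infinite_inj_fin _ (~` range (fun_sum a f)));
    rewrite -setTD; apply: infinite_setD => //.
  exact: finite_image finite_finset.
have auI : injective (fun_sum a u).
  apply: fun_sum_inj => // [i i' ii'|i k E].
    by have := afI (inl i) (inl i') ii'; case.
  by apply: (uP k); exists (inl i).
have aufI : injective (fun_sum (fun_sum a u) f).
  apply: fun_sum_inj => // [j j' jj'|[i|k] j E].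
  - by have := afI (inr j) (inr j') jj'; case.
  - by have := afI (inl i) (inr j) E.
  - by apply: (uP k); exists (inr j).
have [v vI vP] : exists2 v : I -> T, injective v &
    forall i, ~ (range t `|` [set x; y]) (v i).
  apply: (@infinite_inj_fin _ (~` (range t `|` [set x; y])));
    rewrite -setTD; apply: infinite_setD => //.
  rewrite finite_setU; split; last exact: finite_set2.
  exact: finite_image finite_finset.
have vtI : injective (fun_sum v t).
  by apply: fun_sum_inj => // i k E; apply: (vP i); left; exists k.
have [|[i|k] E|[i|k] E|g gG [gt gx]] := @stabiliser_transitive T G1 G2 _ _
  (fun_sum a u) f j0 Tinf G1g G2g indep amalg aufI _ (fun_sum v t) x y vtI.
- by move=> g gG ga; apply: af => // i; exact: (ga (inl i)).
- by apply: (vP i); right; left.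
- exact: (tx k).
- by apply: (vP i); right; right.
- exact: (ty k).
by exists g => //; split=> // k; exact: (gt (inr k)).
Qed.

(** Induction on the length: once the tails match, the stabiliser of the tail [c] moves the image of
    one head to the other. *)
Lemma transitive_off_n_transitive (T : Type) (G : set (T -> T)) :
  perm_group G -> (forall K : finType, transitive_off G K) ->
  forall n, n_transitive G n.
Proof.
move=> [Gid GM GV] trans; elim=> [|n IH] b c.
  by move=> _ _; exists id => //; apply: eq_from_tnth => -[].
case/tupleP: b => x b; case/tupleP: c => y c.
move=> xbI ycI; have [bI xb] := injective_tuple_cons xbI.
have [cI yc] := injective_tuple_cons ycI.
have [g gG gbc] := IH b c bI cI.
have [g' [g'G gK g'K]] := GV _ gG.
have gb i : g (tnth b i) = tnth c i by rewrite -gbc tnth_map.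
have [i E|i E|h hG [hc hx]] := trans _ (tnth c) (g x) y cI.
- apply: xb; suff <- : tnth b i = x by exact: tnth_In.
  by apply: (can_inj gK); rewrite gb.
- by apply: yc; rewrite -E; exact: tnth_In.
exists (h \o g); first exact: GM.
rewrite map_tuple_cons /= hx; congr cons_tuple.
by apply: eq_from_tnth => i; rewrite tnth_map /= gb hc.
Qed.

(** [a] lists the parameters of a formula witnessing algebraicity, and [f] its finitely many
    solutions outside them. Automorphisms fixing the parameters preserve the formula. *)
Lemma has_algebraicity_finite_orbit (tau : signature) (B : structure tau) :
  has_algebraicity B ->
  exists m n (a : 'I_m -> B) (f : 'I_n.+1 -> B), injective (fun_sum a f) /\
    forall g, Aut B g -> (forall i, g (a i) = a i) ->
      forall j, exists j', g (f j) = f j'.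
Proof.
move=> /existsNP[k /existsNP[phi /existsNP[b /not_orP[Sfin Sb]]]].
move: Sfin Sb; set S := [set x | _]; move=> /contrapT Sfin Sb.
have [m [a [aI aP]]] := finite_enum
  (@finite_image _ _ setT (tnth b) finite_finset).
have [n [f [fI fP]]] := finite_enum (finite_setD (range (tnth b)) Sfin).
(* An empty list would leave every solution among the parameters. *)
case: n f fI fP => [|n] f fI fP.
  case: Sb => x Sx; apply: contrapT => xb.
  by have [[]] := (fP x).1 (conj Sx xb).
exists m, n, (tnth a), (tnth f); split.
  apply: fun_sum_inj => // i j E.
  have [_] := (fP _).2 (ex_intro _ j erefl); apply; rewrite -E.
  by apply/aP; exists i.
move=> g gA ga j; have [Sf fb] := (fP _).2 (ex_intro _ j erefl).
have gb i : g (tnth b i) = tnth b i.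
  have [i' <-] := (aP (tnth b i)).1 (ex_intro2 _ _ i I erefl); exact: ga.
suff [j' <-] : exists j', tnth f j' = g (tnth f j) by exists j'.
apply/fP; split.
  have := (sat_iso phi (cons_tuple (tnth f j) b) gA).2 Sf.
  rewrite map_tuple_cons; suff -> : map_tuple g b = b by [].
  by apply: eq_from_tnth => i; rewrite tnth_map gb.
move=> [i _]; rewrite -gb => /(bij_inj gA.1) E.
by apply: fb; exists i.
Qed.

Lemma no_algebraicity_iso (tau : signature) (A B : structure tau)
    (f : A -> B) :
  is_isomorphism f -> no_algebraicity A -> no_algebraicity B.
Proof.
move=> fi noalg n phi b; have [g [gi fK gK]] := iso_inv fi.
have satP x : sat phi (cons_tuple (g x) (map_tuple g b)) <->
              sat phi (cons_tuple x b).
  by rewrite -map_tuple_cons; exact: sat_iso.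
have [Sinf|Sb] := noalg n phi (map_tuple g b); [left|right].
  move=> /(finite_image g) fin; apply: Sinf; apply: sub_finite_set fin.
  by move=> x Sx; exists (f x) => //; apply/satP; rewrite fK.
move=> x /satP/Sb[i _]; rewrite tnth_map => /(can_inj gK) <-.
by exists i.
Qed.

(** * Application to generic combinations *)

Lemma generic_combination_independent (tau1 tau2 : signature)
    (B1 : structure tau1) (B2 : structure tau2)
    (C : structure (sig_union tau1 tau2)) :
  is_generic_combination B1 B2 C ->
  independent (Aut (reductl C)) (Aut (reductr C)).
Proof.
move=> [_ _ indep _] I a b aI bI.
have enumI (c : I -> C) : injective c ->
    injective_tuple [tuple c (enum_val i) | i < #|I|].
  by move=> cI i j; rewrite !tnth_mktuple => /cI/enum_val_inj.
have [_ [[g1 g1A <-] [g2 g2A E]]] := indep _ _ _ (enumI a aI) (enumI b bI).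
exists g1, g2; split=> // i.
have := congr1 (fun t => tnth t (enum_rank i)) E.
by rewrite !tnth_map !tnth_ord_tuple enum_rankK.
Qed.

Lemma generic_combination_amalgamating (tau1 tau2 : signature)
    (B1 : structure tau1) (B2 : structure tau2)
    (C : structure (sig_union tau1 tau2)) :
  is_generic_combination B1 B2 C ->
  amalgamating (Aut (reductl C)) (Aut (reductr C)).
Proof.
move=> [_ _ _ amalg] I a g1 g2 aI g1A g2A E.
pose t := [tuple a (enum_val i) | i < #|I|].
have tI : injective_tuple t.
  by move=> i j; rewrite !tnth_mktuple => /aI/enum_val_inj.
have : (tuple_orbit (Aut (reductl C)) t `&` tuple_orbit (Aut (reductr C)) t)
         (map_tuple g1 t).
  split; first by exists g1.
  exists g2 => //; apply: eq_from_tnth => i.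
  by rewrite !tnth_map !tnth_ord_tuple E.
rewrite amalg // => -[h /Aut_reducts[h1 h2] hE]; exists h; split=> // i.
have := congr1 (fun t => tnth t (enum_rank i)) hE.
by rewrite !tnth_map !tnth_ord_tuple enum_rankK.
Qed.

Lemma independent_sym (T : Type) (G1 G2 : set (T -> T)) :
  independent G1 G2 -> independent G2 G1.
Proof.
move=> indep I a b aI bI; have [g1 [g2 [g1G g2G E]]] := indep I b a bI aI.
by exists g2, g1; split=> // i; rewrite E.
Qed.

Lemma amalgamating_sym (T : Type) (G1 G2 : set (T -> T)) :
  amalgamating G1 G2 -> amalgamating G2 G1.
Proof.
move=> amalg I a g1 g2 aI g1G g2G E.
have [h [h2 h1 hE]] := amalg I a g2 g1 aI g2G g1G (fun i => esym (E i)).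
by exists h; split=> // i; rewrite hE E.
Qed.

Theorem proposition1p1 (tau1 tau2 : signature)
    (B1 : structure tau1) (B2 : structure tau2)
    (infB1 : countably_infinite B1) (infB2 : countably_infinite B2)
    (catB1 : omega_categorical B1) (catB2 : omega_categorical B2) :
  (exists B : structure (sig_union tau1 tau2), is_generic_combination B1 B2 B)
  <->
  (no_algebraicity B1 /\ no_algebraicity B2)
  \/ ((has_algebraicity B1 /\ forall n : nat, n_transitive (Aut B2) n)
      \/ (has_algebraicity B2 /\ forall n : nat, n_transitive (Aut B1) n)).
Proof.
split=> [[C genC]|].
  have [Cinf Cmod _ _] := genC.
  have cC := countably_infinite_countable Cinf.
  have Tinf := countably_infinite_infinite Cinf.
  (* Each reduct of [C] is a countable model of the theory of its component, so categoricity makes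
     the two isomorphic. *)
  have [f1 f1i] : exists f : B1 -> reductl C, is_isomorphism f.
    apply: omega_categorical_isomorphic => //.
      exact: countably_infinite_countable.
    by move=> phi Bphi; apply/sat_formulal/Cmod; left; exists phi.
  have [f2 f2i] : exists f : B2 -> reductr C, is_isomorphism f.
    apply: omega_categorical_isomorphic => //.
      exact: countably_infinite_countable.
    by move=> phi Bphi; apply/sat_formular/Cmod; right; exists phi.
  have [h1 [h1i _ _]] := iso_inv f1i; have [h2 [h2i _ _]] := iso_inv f2i.
  have indep := generic_combination_independent genC.
  have amalg := generic_combination_amalgamating genC.
  have [noalg1|alg1] := pselect (no_algebraicity B1); last first.
    right; left; split=> // n; apply: (n_transitive_iso f2i).
    (* Algebraicity is moved into [C], where it forces high transitivity of the other reduct; this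
       is carried back to [B2] along [f2]. *)
    have : has_algebraicity (reductl C) by move=> /(no_algebraicity_iso h1i).
    move=> /has_algebraicity_finite_orbit[k [l [a [f [afI af]]]]].
    apply: transitive_off_n_transitive; first exact: Aut_perm_group.
    exact: (stabilisers_transitive ord0 Tinf (Aut_perm_group (reductl C))
      (Aut_perm_group (reductr C)) indep amalg afI af).
  have [noalg2|alg2] := pselect (no_algebraicity B2); last first.
    right; right; split=> // n; apply: (n_transitive_iso f1i).
    have : has_algebraicity (reductr C) by move=> /(no_algebraicity_iso h2i).
    move=> /has_algebraicity_finite_orbit[k [l [a [f [afI af]]]]].
    apply: transitive_off_n_transitive; first exact: Aut_perm_group.
    exact: (stabilisers_transitive ord0 Tinf (Aut_perm_group (reductr C))
      (Aut_perm_group (reductl C)) (independent_sym indep)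
      (amalgamating_sym amalg) afI af).
  by left.
move=> [[noalg1 noalg2]|[[_ trans]|[_ trans]]].
- exact: no_algebraicity_generic_combination.
- by apply: highly_transitive_generic_combination => //; right.
- by apply: highly_transitive_generic_combination => //; left.
Qed.
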